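(* Let $n\ge 1$, let $\Pi^n=(t_{\underline{k}})_{\underline{k}\in\mathbb{Z}^n}$ be a node sequence as described in the context, and let $\chi:\mathbb{R}\to\mathbb{R}$ be a one-dimensional kernel (with respect to each of the coordinate sequences $(t_{k_i})_{k_i\in\mathbb{Z}}$, $i=1,\dots,n$). Let $X(\underline{x}):=\prod_{i=1}^n\chi(x_i)$. Assume that $$\chi(x)=\mathcal{O}(|x|^{-2})\quad\text{as } |x|\to+\infty,$$ and that $m_{1,\Pi}(\chi)=+\infty$. Then there exists a constant $K>0$ depending only on the kernel $X$ (and the nodes) such that for every $f\in C(\mathbb{R}^n)$ (uniformly continuous and bounded) $$\|K^X_w f-f\|_\infty\le K\left[\omega\!\left(f,\frac{\log w}{w}\right)+\frac{\|f\|_\infty}{w}\right]$$ for every sufficiently large $w>0$.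
   Context: Nodes: for each $i=1,\dots,n$, $(t_{k_i})_{k_i\in\mathbb{Z}}$ is a strictly increasing real sequence with $t_{k_i}\to\pm\infty$ as $k_i\to\pm\infty$, and there are constants $0<\delta\le\Delta$ with $\delta\le \Delta_{k_i}:=t_{k_i+1}-t_{k_i}\le\Delta$ for all $k_i$ and all $i$. For $\underline{k}=(k_1,\dots,k_n)\in\mathbb{Z}^n$ set $t_{\underline{k}}=(t_{k_1},\dots,t_{k_n})$, $A_{\underline{k}}:=\Delta_{k_1}\cdots\Delta_{k_n}$, and for $w>0$, $R^w_{\underline{k}}:=[t_{k_1}/w,t_{k_1+1}/w]\times\cdots\times[t_{k_n}/w,t_{k_n+1}/w]$ (of Lebesgue measure $A_{\underline{k}}/w^n$). Kernel: a function $X:\mathbb{R}^n\to\mathbb{R}$ is a kernel (w.r.t. the nodes) if ($\chi1$) $X\in L^1(\mathbb{R}^n)$ and $X$ is bounded in a neighborhood of $\underline 0$; ($\chi2$) $\sum_{\underline{k}\in\mathbb{Z}^n}X(\underline{x}-t_{\underline{k}})=1$ for every $\underline{x}\in\mathbb{R}^n$; ($\chi3$) for some $\beta>0$, $m_{\beta,\Pi^n}(X):=\sup_{\underline{x}\in\mathbb{R}^n}\sum_{\underline{k}\in\mathbb{Z}^n}|X(\underline{x}-t_{\underline{k}})|\,\|\underline{x}-t_{\underline{k}}\|_2^\beta<+\infty$. A one-dimensional kernel is the case $n=1$, with moments denoted $m_{\beta,\Pi}(\chi)=\sup_{x\in\mathbb{R}}\sum_{k}|\chi(x-t_k)||x-t_k|^\beta$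 (for $\beta\ge 0$). Sampling Kantorovich operators: for a locally integrable $f:\mathbb{R}^n\to\mathbb{R}$ such that the series converges, $$(K^X_w f)(\underline{x}):=\sum_{\underline{k}\in\mathbb{Z}^n}X(w\underline{x}-t_{\underline{k}})\,\frac{w^n}{A_{\underline{k}}}\int_{R^w_{\underline{k}}}f(\underline{u})\,d\underline{u},\qquad \underline{x}\in\mathbb{R}^n,\ w>0.$$ $C(\mathbb{R}^n)$ denotes the space of uniformly continuous and bounded functions on $\mathbb{R}^n$, with sup norm $\|\cdot\|_\infty$, and $\omega(f,\delta):=\sup_{\|\underline{t}\|_2\le\delta}\sup_{\underline{x}}|f(\underline{x}+\underline{t})-f(\underline{x})|$ is its modulus of continuity. *)

(* Defs.v *)
From HB Require Import structures.
From mathcomp Require Import all_boot all_order all_algebra.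
From mathcomp Require Import all_classical all_reals all_analysis.

Set Implicit Arguments.
Unset Strict Implicit.
Unset Printing Implicit Defensive.

Import Order.TTheory GRing.Theory Num.Theory.
Import numFieldNormedType.Exports.
Local Open Scope classical_set_scope.
Local Open Scope ring_scope.

Section Defs.
Variable R : realType.

Definition sumZ_part (u : int -> R) (N : nat) : R :=
  \sum_(i < (2 * N).+1) u (i%:Z - N%:Z).

Definition sumZ_to (u : int -> R) (l : R) : Prop :=
  sumZ_part u @ \oo --> l.

(* a nonnegative series over Z has a finite value, bounded by M *)
Definition sumZ_bounded_by (u : int -> R) (M : R) : Prop :=
  forall N, sumZ_part u N <= M.

Definition sumZn_part (n : nat) (u : ('I_n -> int) -> R) (N : nat) : R :=
  \sum_(j : {ffun 'I_n -> 'I_((2 * N).+1)})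
     u (fun i => (j i)%:Z - N%:Z).

Definition sumZn (n : nat) (u : ('I_n -> int) -> R) : R :=
  lim (sumZn_part u @ \oo).

Definition norm2 (n : nat) (x : 'I_n -> R) : R :=
  Num.sqrt (\sum_i x i ^+ 2).

Definition nodes (n : nat) (t : 'I_n -> int -> R) (delta Delta : R) : Prop :=
  [/\ 0 < delta /\ delta <= Delta,
      (forall i k, delta <= t i (k + 1) - t i k /\ t i (k + 1) - t i k <= Delta),
      (forall i k1 k2, (k1 < k2)%R -> t i k1 < t i k2),
      (forall i (M : R), exists K : int, forall k, (K <= k)%R -> M <= t i k) &
      (forall i (M : R), exists K : int, forall k, (k <= K)%R -> t i k <= M)].

Definition moment_term (s : int -> R) (chi : R -> R) (beta x : R) (k : int) : R :=
  `|chi (x - s k)| * powR `|x - s k| beta.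

Definition finite_moment (s : int -> R) (chi : R -> R) (beta : R) : Prop :=
  exists M : R, forall x, sumZ_bounded_by (moment_term s chi beta x) M.

Definition kernel1 (s : int -> R) (chi : R -> R) : Prop :=
  [/\ (lebesgue_measure).-integrable setT (EFin \o chi),
      (exists e M : R, 0 < e /\ forall x, `|x| < e -> `|chi x| <= M),
      (forall x, sumZ_to (fun k => chi (x - s k)) 1) &
      (exists beta : R, 0 < beta /\ finite_moment s chi beta)].

Definition bounded_fun (n : nat) (f : ('I_n -> R) -> R) : Prop :=
  exists M : R, forall x, `|f x| <= M.

Definition unif_cont (n : nat) (f : ('I_n -> R) -> R) : Prop :=
  forall e : R, 0 < e -> exists d : R, 0 < d /\
    forall x y, norm2 (fun i => x i - y i) <= d -> `|f x - f y| <= e.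

Definition C_Rn (n : nat) (f : ('I_n -> R) -> R) : Prop :=
  unif_cont f /\ bounded_fun f.

Definition sup_norm (n : nat) (f : ('I_n -> R) -> R) : R :=
  sup [set `|f x| | x in [set: 'I_n -> R]].

Definition modcont (n : nat) (f : ('I_n -> R) -> R) (d : R) : R :=
  sup [set r | exists x t : 'I_n -> R,
          norm2 t <= d /\ r = `|f (fun i => x i + t i) - f x|].

Definition upd (n : nat) (p : 'I_n -> R) (m : nat) (u : R) : 'I_n -> R :=
  fun j => if nat_of_ord j == m then u else p j.

(* iterated Lebesgue integral over the coordinates 0 .. m-1 on the box
   prod_i [a i, b i]; boxint n n a b g is the integral of g over the box *)
Fixpoint boxint (n : nat) (m : nat) (a b : 'I_n -> R)
    (g : ('I_n -> R) -> R) : R :=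
  match m with
  | 0 => g (fun _ => 0)
  | m'.+1 =>
      Rintegral lebesgue_measure
        `[(if insub m' is Some i then a i else 0),
          (if insub m' is Some i then b i else 0)]
        (fun u => boxint m' a b (fun p => g (upd p m' u)))
  end.

Definition prodkernel (n : nat) (chi : R -> R) (x : 'I_n -> R) : R :=
  \prod_i chi (x i).

Definition kantorovich (n : nat) (t : 'I_n -> int -> R) (X : ('I_n -> R) -> R)
    (w : R) (f : ('I_n -> R) -> R) (x : 'I_n -> R) : R :=
  sumZn (fun k : 'I_n -> int =>
    X (fun i => w * x i - t i (k i)) *
    (w ^+ n / \prod_i (t i (k i + 1) - t i (k i))) *
    boxint n (fun i => t i (k i) / w) (fun i => t i (k i + 1) / w) f).

End Defs.

(* Main.v *)
(* Axiom (chi1) bounds [chi] near 0 and (chi3) bounds it outside any neighborhood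
   of 0, so with the growth hypothesis [|chi y| <= C0 / (1 + |y|)^2] everywhere. As the nodes are
   separated by [delta], uniformly in [x] the sum of [|chi (x - t_k)|] is
   bounded, its part beyond distance [w] is [O(1/w)], and its first moment up to
   distance [w] is [O(log w)]. Because the translates of the product kernel sum
   to 1, the error is a weighted sum of (mean of [f] on a box) - [f x], and each
   such difference is at most
     omega(log w / w) * (1 + (sum_i |w x_i - t_{k_i}| + n Delta) / log w)
   if all [|w x_i - t_{k_i}| <= w], and at most [2 ||f||] otherwise. Both cases
   are dominated by a sum over [i] of functions of [k_i] alone, so the
   n-dimensional series factors into one-dimensional ones. *)
Require Import Defs.
From HB Require Import structures.
From mathcomp Require Import all_boot all_order all_algebra.
From mathcomp Require Import all_classical all_reals all_analysis.
From mathcomp Require Import ring lra.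
Import Order.TTheory GRing.Theory Num.Theory.
Import numFieldNormedType.Exports.
Local Open Scope classical_set_scope.
Local Open Scope ring_scope.

Set Implicit Arguments.
Unset Strict Implicit.

(** * One-dimensional sums over separated nodes *)

Lemma ratio_abs_mono (R : realType) (c x y : R) : 0 < c -> x <= y ->
  x / (c + `|x|) <= y / (c + `|y|).
Proof.
move=> c0 xy; have cx : 0 < c + `|x| by rewrite ltr_wpDr.
have cy : 0 < c + `|y| by rewrite ltr_wpDr.
rewrite ler_pdivrMr // mulrAC ler_pdivlMr //.
by case: (ger0P x) => hx; case: (ger0P y) => hy; nra.
Qed.

(** On [[s, s + d]] the derivative of [x / (c + |x|)] is at least [c / (c + |s| + d)^2], so the
    function gains at least [d] times that. As [c >= 1], [c + |s| + d <= (1 + d) (c + |s|)], which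
    is where the factor [(1 + d)^2] comes from. *)
Lemma inv_sqr_le_telescope (R : realType) (c d s r : R) :
  1 <= c -> 0 < d -> s + d <= r ->
  ((c + `|s|) ^+ 2)^-1 <=
    (1 + d) ^+ 2 / (c * d) * (r / (c + `|r|) - s / (c + `|s|)).
Proof.
move=> c1 d0 sr.
have c0 : 0 < c by apply: lt_le_trans c1.
have cs : 0 < c + `|s| by rewrite ltr_wpDr.
have csd : 0 < c + `|s| + d by rewrite addr_gt0.
have K0 : 0 < (1 + d) ^+ 2 / (c * d).
  by rewrite divr_gt0 ?mulr_gt0 ?exprn_gt0 // addr_gt0.
have step : c * d / (c + `|s| + d) ^+ 2 <=
    (s + d) / (c + `|s + d|) - s / (c + `|s|).
  case: (ger0P s) => hs.
    rewrite (ger0_norm (_ : 0 <= s + d)); last by lra.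
    have -> : (s + d) / (c + (s + d)) - s / (c + s) =
        c * d / ((c + s) * (c + s + d)).
      by field; apply/andP; split; apply: lt0r_neq0; lra.
    rewrite ler_pM2l ?mulr_gt0 // lef_pV2 ?posrE ?exprn_gt0 ?mulr_gt0 //; nra.
  rewrite (ltr0_norm hs) in cs csd.
  case: (ger0P (s + d)) => hsd.
    (* Here 0 lies in [[s, s + d]]: both fractions are bounded below with the common denominator
       [c + d], and together they leave [d / (c + d)]. *)
    rewrite -mulNr.
    have h1 : - s / (c + d) <= - s / (c - s).
      by rewrite ler_pM2l ?oppr_gt0 // lef_pV2 ?posrE; lra.
    have h2 : (s + d) / (c + d) <= (s + d) / (c + (s + d)).
      by rewrite ler_wpM2l // lef_pV2 ?posrE; lra.
    apply: le_trans (lerD h2 h1); rewrite -mulrDl.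
    have -> : s + d - s = d by ring.
    rewrite ler_pdivlMr; last by lra.
    rewrite mulrAC ler_pdivrMr ?exprn_gt0 //.
    have : (c + d) * c <= (c - s + d) ^+ 2 by nra.
    by move=> h; rewrite [c * d]mulrC -mulrA ler_pM2l // mulrC.
  have -> : (s + d) / (c - (s + d)) - s / (c - s) =
      c * d / ((c - s) * (c - s - d)).
    by field; apply/andP; split; apply: lt0r_neq0; lra.
  by rewrite ler_pM2l ?mulr_gt0 // lef_pV2 ?posrE ?exprn_gt0 ?mulr_gt0 //; nra.
apply: le_trans (_ : (1 + d) ^+ 2 / (c * d) * (c * d / (c + `|s| + d) ^+ 2) <= _).
  have -> : (1 + d) ^+ 2 / (c * d) * (c * d / (c + `|s| + d) ^+ 2) =
      (1 + d) ^+ 2 / (c + `|s| + d) ^+ 2.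
    by field; apply/and3P; split; apply: lt0r_neq0.
  rewrite ler_pdivlMr ?exprn_gt0 // mulrC ler_pdivrMr ?exprn_gt0 // -exprMn.
  have s0 := normr_ge0 s.
  by rewrite ler_sqr ?nnegrE; nra.
rewrite ler_pM2l //; apply: le_trans step _.
by rewrite lerD2r; apply: ratio_abs_mono.
Qed.

Lemma sumZ_part_le (R : realType) (u v : int -> R) N :
  (forall k, u k <= v k) -> sumZ_part u N <= sumZ_part v N.
Proof. by move=> uv; apply: ler_sum. Qed.

Lemma sumZ_partD (R : realType) (u v : int -> R) N :
  sumZ_part (fun k => u k + v k) N = sumZ_part u N + sumZ_part v N.
Proof. exact: big_split. Qed.

Lemma sumZ_partZ (R : realType) (a : R) (u : int -> R) N :
  sumZ_part (fun k => a * u k) N = a * sumZ_part u N.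
Proof. by rewrite /sumZ_part mulr_sumr. Qed.

(* Since [x / (c + |x|)] has derivative [c / (c + |x|)^2], the sum telescopes. *)
Lemma sum_inv_sqr_le (R : realType) (u : int -> R) (d c : R) N :
  0 < d -> 1 <= c -> (forall k, d <= u (k + 1) - u k) ->
  sumZ_part (fun k => ((c + `|u k|) ^+ 2)^-1) N <= 2 * (1 + d) ^+ 2 / d / c.
Proof.
move=> d0 c1 gap; have c0 : 0 < c by apply: lt_le_trans c1.
pose F (x : R) := x / (c + `|x|); pose G i := F (u (i%:Z - N%:Z)).
have K0 : 0 <= (1 + d) ^+ 2 / (c * d).
  by rewrite divr_ge0 ?mulr_ge0 ?exprn_ge0 //; lra.
apply: le_trans (_ : (1 + d) ^+ 2 / (c * d) * (G (2 * N).+1 - G 0%N) <= _).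
  rewrite -telescope_sumr // big_mkord mulr_sumr; apply: ler_sum => i _.
  have -> : G i.+1 = F (u (i%:Z - N%:Z + 1)).
    by rewrite /G; congr (F (u _)); rewrite intS; ring.
  by apply: inv_sqr_le_telescope => //; have := gap (i%:Z - N%:Z); lra.
have F1 x : `|F x| <= 1.
  have h : 0 < c + `|x| by rewrite ltr_wpDr.
  rewrite /F normrM normfV (gtr0_norm h) ler_pdivrMr // mul1r lerDr.
  exact: ltW.
have -> : 2 * (1 + d) ^+ 2 / d / c = (1 + d) ^+ 2 / (c * d) * 2.
  by field; apply/andP; split; apply: lt0r_neq0.
rewrite ler_wpM2l // /G.
have := F1 (u ((2 * N).+1%:Z - N%:Z)); have := F1 (u (0%:Z - N%:Z)).
by rewrite !ler_norml => /andP[? ?] /andP[? ?]; lra.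
Qed.

Lemma harmonic_le (R : realType) M :
  \sum_(c < M.+1) (c.+1%:R : R)^-1 <= 1 + ln (M.+1%:R).
Proof.
elim: M => [|M IH]; first by rewrite big_ord1 invr1 ln1 addr0.
rewrite big_ord_recr /=; apply: le_trans (lerD IH (lexx _)) _.
rewrite -addrA lerD2l.
have M0 : 0 < M.+1%:R :> R by rewrite ltr0n.
have M1 : 0 < M.+2%:R :> R by rewrite ltr0n.
have MS : M.+2%:R = M.+1%:R + 1 :> R by rewrite -natr1.
have E : 1 + - (M.+2%:R)^-1 = M.+1%:R / M.+2%:R :> R.
  by move: M1; rewrite MS; set y := M.+1%:R => y0; field; apply: lt0r_neq0.
(* [ln (1 + x) <= x] at [x = -1 / (M + 2)] bounds the new term by [ln (M + 2) - ln (M + 1)]. *)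
have := @le_ln1Dx R (- (M.+2%:R)^-1).
rewrite E ln_div ?posrE // ltrN2 invf_lt1 // ltr1n => /(_ isT).
by move=> h; rewrite -lerBrDr; rewrite lerBlDr addrC in h.
Qed.

(** Each term is at least [1 / ((a + y) (a + 1 + y))] with [a = c + 1], and these telescope to
    [1 / (1 + y) - 1 / (M + 1 + y)]. For [y <= M] and [M >= 1] that is at least a third of
    [1 / (1 + y)]. *)
Lemma inv_le_sum_inv_sqr (R : realType) (y : R) M : (0 < M)%N ->
  0 <= y -> y <= M%:R ->
  (1 + y)^-1 <= 3 * \sum_(c < M) ((c.+1%:R + y) ^+ 2)^-1.
Proof.
move=> M0 y0 yM.
have M1 : 1 <= M%:R :> R by rewrite ler1n.
have -> : (1 + y)^-1 = 3 * ((1 + y)^-1 / 3) by field; apply: lt0r_neq0; lra.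
rewrite ler_pM2l //.
apply: le_trans (_ : (1 + y)^-1 - (M%:R + 1 + y)^-1 <= _).
  have -> : (1 + y)^-1 - (M%:R + 1 + y)^-1 =
      (1 + y)^-1 * (M%:R / (M%:R + 1 + y)).
    by field; apply/andP; split; apply: lt0r_neq0; lra.
  rewrite ler_pM2l ?invr_gt0; last lra.
  by rewrite ler_pdivlMr; lra.
pose G i : R := - (i.+1%:R + y)^-1.
have -> : (1 + y)^-1 - (M%:R + 1 + y)^-1 = G M - G 0%N.
  by rewrite /G -natr1 opprK addrC.
rewrite -telescope_sumr // big_mkord; apply: ler_sum => i _.
rewrite /G -[i.+2%:R]natr1 opprK.
have i0 : 1 <= i.+1%:R :> R by rewrite ler1n.
set a : R := i.+1%:R in i0 *.
have -> : - (a + 1 + y)^-1 + (a + y)^-1 = ((a + y) * (a + 1 + y))^-1.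
  by field; apply/andP; split; apply: lt0r_neq0; lra.
by rewrite lef_pV2 ?posrE ?exprn_gt0 ?mulr_gt0; nra.
Qed.

(* [inv_le_sum_inv_sqr] writes the summand through the quadratic ones; summing their
   bounds over [c] gives a harmonic sum, hence the logarithm. *)
Lemma sum_trunc_inv_le (R : realType) (u : int -> R) (d L : R) N :
  0 < d -> 1 <= ln L -> 1 <= L -> (forall k, d <= u (k + 1) - u k) ->
  sumZ_part (fun k => if `|u k| <= L then (1 + `|u k|)^-1 else 0) N <=
    2 * (1 + d) ^+ 2 / d * (9 * ln L).
Proof.
move=> d0 lnL L1 gap; set B := 2 * (1 + d) ^+ 2 / d.
have B0 : 0 <= B by rewrite !mulr_ge0 ?exprn_ge0 ?invr_ge0 //; lra.
have L0 : 0 <= L by apply: le_trans L1.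
pose M := (Num.truncn L).+1.
have LM : L <= M%:R by rewrite ltW // truncnS_gt.
have ML : M%:R <= L + 1 by rewrite -natr1 lerD2r; case/andP: (truncn_itv L0).
apply: le_trans (_ : sumZ_part (fun k => 3 *
   \sum_(c < M) ((c.+1%:R + `|u k|) ^+ 2)^-1) N <= _).
  apply: sumZ_part_le => k; case: ifP => [uL|_].
    by apply: inv_le_sum_inv_sqr => //; exact: le_trans LM.
  by rewrite mulr_ge0 // sumr_ge0 // => i _; rewrite invr_ge0 sqr_ge0.
rewrite sumZ_partZ /sumZ_part exchange_big /=.
apply: le_trans (_ : 3 * \sum_(c < M) B * (c.+1%:R)^-1 <= _).
  rewrite ler_pM2l //; apply: ler_sum => c _.
  by apply: (sum_inv_sqr_le (c := c.+1%:R)) => //; rewrite ler1n.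
rewrite -mulr_sumr mulrCA ler_wpM2l //.
(* One factor 3 comes from [inv_le_sum_inv_sqr]; the other from [M <= 2 L], so that
   [1 + ln M <= 2 + ln L <= 3 ln L]. *)
have -> : 9 * ln L = 3 * (3 * ln L) by ring.
rewrite ler_pM2l //; apply: le_trans (harmonic_le _ _) _.
have : ln (M%:R : R) <= ln L + ln 2.
  rewrite -lnM ?posrE //; last by lra.
  by rewrite ler_ln ?posrE ?ltr0n //; lra.
have : ln (2 : R) <= 1 by have := @le_ln1Dx R 1; rewrite -[1 + 1]/(2 : R); apply; lra.
by rewrite -/M; lra.
Qed.

(** The weight has a constant part [a], a part of slope [b] up to distance [L] and a part [e] beyond
    it; the theorem takes [L = w]. Against the quadratic decay the slope leaves a truncated sum of
    [1 / (1 + y)]. For [y > L], [1 + L + y <= 2 (1 + y)], so the far part is at most 4 times a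
    quadratic sum with [c = 1 + L], of order [1 / L]. *)
Lemma sum_decay_weight_le (R : realType) (chi : R -> R) (s : int -> R)
    (C0 d L a b e x : R) N :
  0 < d -> 1 <= ln L -> 1 <= L -> (forall k, d <= s (k + 1) - s k) ->
  (forall y, `|chi y| <= C0 / (1 + `|y|) ^+ 2) ->
  0 <= a -> 0 <= b -> 0 <= e ->
  sumZ_part (fun k => `|chi (x - s k)| *
     (a + (if `|x - s k| <= L then b * `|x - s k| else e))) N <=
   C0 * (2 * (1 + d) ^+ 2 / d) * (a + 9 * (b * ln L) + 4 * (e / L)).
Proof.
move=> d0 lnL L1 gap dec a0 b0 e0; set B := 2 * (1 + d) ^+ 2 / d.
pose u k := s k - x.
have ugap k : d <= u (k + 1) - u k by rewrite /u; have := gap k; lra.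
have C00 : 0 <= C0.
  have := le_trans (normr_ge0 _) (dec 0).
  by rewrite normr0 addr0 expr1n divr1.
have B0 : 0 <= B by rewrite !mulr_ge0 ?exprn_ge0 ?invr_ge0 //; lra.
apply: le_trans (_ : C0 * (a * sumZ_part (fun k => ((1 + `|u k|) ^+ 2)^-1) N +
    b * sumZ_part (fun k => if `|u k| <= L then (1 + `|u k|)^-1 else 0) N +
    4 * e * sumZ_part (fun k => ((1 + L + `|u k|) ^+ 2)^-1) N) <= _); last first.
  rewrite -[leRHS]mulrA ler_wpM2l //.
  have h1 := @sum_inv_sqr_le R u d 1 N d0 (lexx _) ugap.
  have h2 := @sum_trunc_inv_le R u d L N d0 lnL L1 ugap.
  have h3 := @sum_inv_sqr_le R u d (1 + L) N d0 ltac:(lra) ugap.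
  rewrite -/B in h1 h2 h3.
  have h4 : B / (1 + L) <= B / L.
    by rewrite ler_wpM2l // lef_pV2 ?posrE; lra.
  have h5 := le_trans h3 h4.
  rewrite divr1 in h1.
  have e40 : 0 <= 4 * e by lra.
  have := lerD (lerD (ler_wpM2l a0 h1) (ler_wpM2l b0 h2)) (ler_wpM2l e40 h5).
  by move/le_trans; apply; rewrite le_eqVlt; apply/orP; left; apply/eqP; ring.
rewrite -!sumZ_partZ -!sumZ_partD -sumZ_partZ.
apply: sumZ_part_le => k.
have -> : `|x - s k| = `|u k| by rewrite /u distrC.
have {}dec : `|chi (x - s k)| <= C0 / (1 + `|u k|) ^+ 2.
  by rewrite /u distrC; apply: dec.
have y0 := normr_ge0 (u k); set y := `|u k| in dec y0 *.
set g := (a + _).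
have g0 : 0 <= g by rewrite /g; case: ifP => _; rewrite addr_ge0 ?mulr_ge0.
apply: le_trans (ler_wpM2r g0 dec) _; rewrite -[leLHS]mulrA ler_wpM2l //.
have y1 : 0 < 1 + y by lra.
rewrite mulrC /g mulrDl -addrA lerD2l; case: ifPn => yL.
  rewrite -[leLHS]mulrA; apply: ler_wpDr.
    by rewrite !mulr_ge0 ?invr_ge0 ?sqr_ge0.
  rewrite ler_wpM2l // ler_pdivrMr ?exprn_gt0 // expr2 mulKf ?lt0r_neq0 //; lra.
rewrite mulr0 add0r (mulrC 4) -[leRHS]mulrA ler_wpM2l //.
have LyL : 0 < 1 + L + y by lra.
rewrite ler_pdivlMr ?exprn_gt0 // mulrC ler_pdivrMr ?exprn_gt0 //.
rewrite -ltNge in yL.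
have -> : 4 * (1 + y) ^+ 2 = (2 * (1 + y)) ^+ 2 by ring.
by rewrite ler_sqr ?nnegrE; lra.
Qed.

(** * Global quadratic decay of the kernel *)

Lemma kernel1_decay (R : realType) (s : int -> R) (chi : R -> R) :
  kernel1 s chi ->
  (exists C A : R, 0 < A /\
     forall x : R, A <= `|x| -> `|chi x| <= C * `|x| ^- 2) ->
  exists C0, 0 < C0 /\ forall y, `|chi y| <= C0 / (1 + `|y|) ^+ 2.
Proof.
case=> _ [e [M0 [e0 hM0]]] _ [beta [beta0 [M1 hM1]]] [C [A [A0 hA]]].
pose B := `|M0| + `|M1| / e `^ beta + 1.
have eb : 0 < e `^ beta by rewrite powR_gt0.
have B0 : 0 < B.
  by rewrite /B ltr_wpDl // addr_ge0 // divr_ge0 // ltW.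
have bd y : `|chi y| <= B.
  case: (ltP `|y| e) => ye.
    apply: le_trans (hM0 _ ye) _; apply: le_trans (ler_norm _) _.
    by rewrite /B -addrA lerDl addr_ge0 // divr_ge0 // ltW.
  (* The partial sum with [N = 0] is the single term [k = 0]; at the point [y + s 0] it equals
     [|chi y| |y|^beta]. *)
  have := hM1 (y + s 0) 0%N.
  rewrite /sumZ_part /moment_term big_ord1 /= subr0 addrK => h.
  have : `|chi y| <= `|M1| / e `^ beta.
    rewrite ler_pdivlMr //; apply: le_trans (le_trans h (ler_norm _)).
    by rewrite ler_wpM2l // ge0_ler_powR ?nnegrE // ltW.
  by have := normr_ge0 M0; rewrite /B; lra.
(* Beyond [A1] one has [|y| >= 1], hence [(1 + |y|)^2 <= 4 |y|^2]. *)
pose A1 := A + 1.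
exists (B * (1 + A1) ^+ 2 + 4 * `|C|); split.
  by rewrite ltr_pwDl // mulr_gt0 // exprn_gt0 // /A1; lra.
move=> y; have y0 := normr_ge0 y.
have y1 : 0 < (1 + `|y|) ^+ 2 by rewrite exprn_gt0 //; lra.
rewrite ler_pdivlMr //.
case: (ltP `|y| A1) => yA.
  apply: ler_wpDr; first by rewrite mulr_ge0.
  apply: ler_pM; [exact: normr_ge0|exact: sqr_ge0|exact: bd|].
  by rewrite ler_sqr ?nnegrE; rewrite /A1 in yA *; lra.
rewrite /A1 in yA *.
have yp : 0 < `|y| by lra.
apply: ler_wpDl; first exact: mulr_ge0 (ltW B0) (sqr_ge0 _).
apply: le_trans (_ : `|C| * `|y| ^- 2 * (1 + `|y|) ^+ 2 <= _).
  apply: ler_wpM2r; first exact: ltW.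
  apply: le_trans (hA _ _) _; first by lra.
  by rewrite ler_wpM2r ?ler_norm // invr_ge0 sqr_ge0.
rewrite mulrAC ler_pdivrMr ?exprn_gt0 // [4 * _]mulrC -[leRHS]mulrA ler_wpM2l //.
nra.
Qed.

(** * Euclidean norm and coordinate updates *)

Lemma norm2_ge0 (R : realType) n (x : 'I_n -> R) : 0 <= norm2 x.
Proof. exact: sqrtr_ge0. Qed.

Lemma norm2Z (R : realType) n (a : R) (x : 'I_n -> R) : 0 <= a ->
  norm2 (fun i => a * x i) = a * norm2 x.
Proof.
move=> a0; rewrite /norm2; under eq_bigr do rewrite exprMn.
by rewrite -mulr_sumr sqrtrM ?sqr_ge0 // sqrtr_sqr ger0_norm.
Qed.

Lemma norm2_le_sum (R : realType) n (x y : 'I_n -> R) :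
  (forall i, `|x i| <= y i) -> norm2 x <= \sum_i y i.
Proof.
move=> xy; have y0 i : 0 <= y i := le_trans (normr_ge0 _) (xy i).
have S0 : 0 <= \sum_i y i by apply: sumr_ge0.
rewrite -(ger0_norm S0) -sqrtr_sqr /norm2 ler_sqrt ?sqr_ge0 //.
rewrite [leRHS]expr2 mulr_suml; apply: ler_sum => i _.
apply: le_trans (_ : y i * y i <= _).
  by rewrite -(ger0_norm (sqr_ge0 (x i))) expr2 normrM ler_pM.
by rewrite ler_wpM2l // (bigD1 i) //= lerDl sumr_ge0.
Qed.

Lemma norm2_upd_le (R : realType) n (p q : 'I_n -> R) m u :
  norm2 (fun i => upd p m u i - upd q m u i) <= norm2 (fun i => p i - q i).
Proof.
rewrite /norm2 ler_sqrt ?sumr_ge0 // => [|i _]; last exact: sqr_ge0.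
apply: ler_sum => i _; rewrite /upd; case: ifP => // _.
by rewrite subrr expr0n sqr_ge0.
Qed.

Lemma norm2_upd_upd_le (R : realType) n (p : 'I_n -> R) m u v :
  norm2 (fun i => upd p m u i - upd p m v i) <= `|u - v|.
Proof.
rewrite -sqrtr_sqr /norm2 ler_sqrt ?sqr_ge0 //.
case: (ltnP m n) => mn; last first.
  rewrite big1 ?sqr_ge0 // => i _.
  by rewrite /upd (ltn_eqF (leq_trans (ltn_ord i) mn)) subrr expr0n.
rewrite (bigD1 (Ordinal mn)) //= big1 => [|i im]; rewrite /upd.
  by rewrite /= eqxx addr0.
by rewrite (negbTE (im : nat_of_ord i != m)) subrr expr0n.
Qed.

Lemma unif_cont_upd (R : realType) n (g : ('I_n -> R) -> R) m u :
  unif_cont g -> unif_cont (fun p => g (upd p m u)).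
Proof.
move=> ug e e0; have [d [d0 h]] := ug e e0; exists d; split=> // p q pq.
by apply: h; apply: le_trans (norm2_upd_le _ _ _ _) pq.
Qed.

(** * Iterated integrals and means over boxes *)

Lemma Rintegral_itv_cst (R : realType) (a b c : R) : a <= b ->
  \int[lebesgue_measure]_(x in `[a, b]) c = c * (b - a).
Proof.
move=> ab; rewrite Rintegral_cst //= lebesgue_measure_itv /= lte_fin.
case: ltP => // ba; have -> : a = b by apply/eqP; rewrite eq_le ab.
by rewrite subrr.
Qed.

Lemma boxint_cst (R : realType) n m (a b : 'I_n -> R) c : (m <= n)%N ->
  (forall i, a i <= b i) ->
  boxint m a b (fun=> c) = c * \prod_(i < n | (i < m)%N) (b i - a i).
Proof.
move=> + ab; elim: m => [|m IH] mn /=; first by rewrite big_pred0 // mulr1.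
rewrite insubT /= IH ?(ltnW mn) // Rintegral_itv_cst //.
rewrite [in RHS](bigD1 (Ordinal mn)) //= -mulrA [X in _ * X]mulrC.
congr (_ * (_ * _)); apply: eq_bigl => i.
by rewrite ltnS -(inj_eq val_inj) /= [RHS]andbC ltn_neqAle.
Qed.

(* The induction needs the integrands of [boxint] to be continuous; that is the
   statement itself, applied to two slices of one function. *)
Lemma boxint_dist_le (R : realType) n m (a b : 'I_n -> R)
    (g h : ('I_n -> R) -> R) (e : R) :
  (m <= n)%N -> (forall i, a i <= b i) -> 0 <= e ->
  unif_cont g -> unif_cont h ->
  (forall p, (forall j : 'I_n, (j < m)%N -> a j <= p j <= b j) ->
     `|g p - h p| <= e) ->
  `|boxint m a b g - boxint m a b h| <=
    e * \prod_(i < n | (i < m)%N) (b i - a i).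
Proof.
move=> + ab; elim: m g h e => [|m IH] g h e mn e0 ug uh gh /=.
  by rewrite big_pred0 // mulr1; apply: gh.
rewrite insubT /=; set i0 : 'I_n := Sub m mn.
pose V := \prod_(i < n | (i < m)%N) (b i - a i).
have V0 : 0 <= V by apply: prodr_ge0 => i _; rewrite subr_ge0.
have mn' := ltnW mn.
have slice_int (f : ('I_n -> R) -> R) : unif_cont f ->
    lebesgue_measure.-integrable `[a i0, b i0]
      (EFin \o (fun u => boxint m a b (fun p => f (upd p m u)))).
  move=> uf; apply: continuous_compact_integrable; first exact: segment_compact.
  apply: continuous_subspaceT => u; apply/cvgrPdist_le => /= eps eps0.
  (* Dividing by [V + 1] instead of [V] allows for a degenerate box. *)
  have V1 : 0 < V + 1 by rewrite ltr_wpDl.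
  have [d [d0 hd]] := uf (eps / (V + 1)) (divr_gt0 eps0 V1).
  have : \forall v \near u, `|u - v| <= d.
    by have /cvgrPdist_le := @cvg_id _ (nbhs u); exact.
  apply: filterS => v uv.
  apply: le_trans (IH _ _ (eps / (V + 1)) mn' _ _ _ _) _.
  - by rewrite ltW // divr_gt0.
  - exact: unif_cont_upd.
  - exact: unif_cont_upd.
  - by move=> p _; apply: hd; apply: le_trans (norm2_upd_upd_le _ _ _ _) uv.
  - rewrite -/V mulrAC ler_pdivrMr // ler_wpM2l ?lerDl //; exact: ltW.
have ig := slice_int _ ug; have ih := slice_int _ uh.
rewrite -RintegralB //.
have igh : lebesgue_measure.-integrable `[a i0, b i0] (EFin \o
    (fun u => boxint m a b (fun p => g (upd p m u)) -
              boxint m a b (fun p => h (upd p m u)))).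
  have := integrableB _ ig ih; rewrite /comp; apply => //.
apply: le_trans (le_normr_Rintegral _ igh) _ => //.
apply: le_trans (_ : \int[lebesgue_measure]_(x in `[a i0, b i0]) (e * V) <= _).
  apply: le_Rintegral => //.
  - exact: integrable_norm.
  - apply: continuous_compact_integrable; first exact: segment_compact.
    by apply: continuous_subspaceT => u; exact: cvg_cst.
  move=> u; rewrite /= in_itv /= => uab; apply: IH => //.
  - exact: unif_cont_upd.
  - exact: unif_cont_upd.
  move=> p hp; apply: gh => j jm; rewrite /upd; case: eqP => [jE|/eqP jE].
    by have -> : j = i0 by apply: val_inj.
  by apply: hp; rewrite ltn_neqAle jE -ltnS.
rewrite Rintegral_itv_cst // le_eqVlt; apply/orP; left; apply/eqP.
rewrite [in RHS](bigD1 i0) //= -mulrA [X in _ * X]mulrC.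
congr (_ * (_ * _)); apply: eq_bigl => i.
by rewrite ltnS -(inj_eq val_inj) /= [RHS]andbC ltn_neqAle.
Qed.

Lemma unif_cont_cst (R : realType) n (c : R) :
  unif_cont (fun _ : 'I_n -> R => c).
Proof.
by move=> e e0; exists 1; split=> // x y _; rewrite subrr normr0 ltW.
Qed.

(** The constant [c] is its own mean, so this is [boxint_dist_le] against a constant function,
    divided by the volume. *)
Lemma boxint_mean_dist_le (R : realType) n (a b : 'I_n -> R)
    (f : ('I_n -> R) -> R) (c e : R) :
  (forall i, a i < b i) -> 0 <= e -> unif_cont f ->
  (forall p, (forall j, a j <= p j <= b j) -> `|f p - c| <= e) ->
  `|(\prod_i (b i - a i))^-1 * boxint n a b f - c| <= e.
Proof.
move=> ab e0 uf fc.
have ab' i : a i <= b i by apply: ltW.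
have V0 : 0 < \prod_i (b i - a i) by apply: prodr_gt0 => i _; rewrite subr_gt0.
have VE : \prod_(i < n | (i < n)%N) (b i - a i) = \prod_i (b i - a i).
  by apply: eq_bigl => i; rewrite ltn_ord.
have := boxint_dist_le (leqnn n) ab' e0 uf (@unif_cont_cst R n c)
  (fun p hp => fc p (fun j => hp j (ltn_ord j))).
rewrite boxint_cst // VE => h.
have -> : (\prod_i (b i - a i))^-1 * boxint n a b f - c =
    (\prod_i (b i - a i))^-1 * (boxint n a b f - c * \prod_i (b i - a i)).
  by rewrite mulrBr (mulrC c) mulKf ?lt0r_neq0.
rewrite normrM gtr0_norm ?invr_gt0 // mulrC ler_pdivrMr //.
Qed.

(** * Modulus of continuity and sup norm *)

Lemma modcont_ge (R : realType) n (f : ('I_n -> R) -> R) d x s :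
  Defs.bounded_fun f -> norm2 s <= d ->
  `|f (fun i => x i + s i) - f x| <= modcont f d.
Proof.
move=> [M hM] sd; apply: ub_le_sup; last by exists x, s.
(* [modcont] is a real-valued [sup], which dominates the set only once the set is known to be
   bounded above. *)
exists (M + M) => _ [y [r [_ ->]]].
by apply: le_trans (ler_normB _ _) _; apply: lerD; exact: hM.
Qed.

Lemma modcont_ge0 (R : realType) n (f : ('I_n -> R) -> R) d :
  Defs.bounded_fun f -> 0 <= d -> 0 <= modcont f d.
Proof.
move=> bf d0; have n0 : norm2 (fun _ : 'I_n => 0 : R) <= d.
  by rewrite /norm2 big1 ?sqrtr0 // => i _; exact: expr0n.
exact: le_trans (normr_ge0 _) (modcont_ge (fun=> 0) bf n0).
Qed.

Lemma sup_norm_ge (R : realType) n (f : ('I_n -> R) -> R) x :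
  Defs.bounded_fun f -> `|f x| <= sup_norm f.
Proof.
move=> [M hM]; apply: ub_le_sup; last by exists x.
by exists M => _ [y _ <-].
Qed.

Lemma modcont_mul (R : realType) n (f : ('I_n -> R) -> R) d x s m :
  Defs.bounded_fun f -> norm2 s <= d ->
  `|f (fun i => x i + m%:R * s i) - f x| <= m%:R * modcont f d.
Proof.
move=> bf sd; elim: m => [|m IH].
  rewrite mul0r (_ : (fun i => _) = x) ?subrr ?normr0 //.
  by apply/funext => i; rewrite mul0r addr0.
apply: le_trans (ler_distD (f (fun i => x i + m%:R * s i)) _ _) _.
rewrite -natr1 mulrDl mul1r addrC; apply: lerD => //.
rewrite (_ : (fun i => x i + (m%:R + 1) * s i) =
  (fun i => (x i + m%:R * s i) + s i)); first exact: modcont_ge.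
by apply/funext => i; rewrite mulrDl mul1r addrA.
Qed.

(** The segment from [x] to [y], of length [N], is cut into [floor (N / d) + 1] equal steps of
    length at most [d], each costing at most [modcont f d]. *)
Lemma modcont_scale (R : realType) n (f : ('I_n -> R) -> R) d x y :
  Defs.bounded_fun f -> 0 < d ->
  `|f y - f x| <= modcont f d * (1 + norm2 (fun i => y i - x i) / d).
Proof.
move=> bf d0; set N := norm2 _.
have N0 : 0 <= N / d by rewrite divr_ge0 ?norm2_ge0 // ltW.
pose m := (Num.truncn (N / d)).+1.
have m0 : 0 < m%:R :> R by rewrite ltr0n.
have Nm : N / d <= m%:R by rewrite ltW // truncnS_gt.
have mN : m%:R <= 1 + N / d.
  by rewrite -natr1 addrC lerD2l; case/andP: (truncn_itv N0).
have w0 := modcont_ge0 bf (ltW d0).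
have sd : norm2 (fun i => m%:R^-1 * (y i - x i)) <= d.
  rewrite norm2Z ?invr_ge0 ?(ltW m0) // mulrC ler_pdivrMr // mulrC.
  by rewrite -ler_pdivrMr.
have := modcont_mul x m bf sd.
rewrite (_ : (fun i => x i + m%:R * _) = y); last first.
  by apply/funext => i; rewrite mulrA divff ?lt0r_neq0 // mul1r addrC subrK.
move/le_trans; apply; rewrite mulrC; exact: ler_wpM2l.
Qed.

(** * Cubical partial sums of n-dimensional series *)

Lemma sumZn_part_prod (R : realType) n (v : 'I_n -> int -> R) N :
  sumZn_part (fun k => \prod_i v i (k i)) N = \prod_i sumZ_part (v i) N.
Proof. by rewrite /sumZn_part /sumZ_part bigA_distr_bigA. Qed.

Lemma sumZn_part_le (R : realType) n (u v : ('I_n -> int) -> R) N :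
  (forall k, u k <= v k) -> sumZn_part u N <= sumZn_part v N.
Proof. by move=> uv; apply: ler_sum. Qed.

Lemma sumZn_partD (R : realType) n (u v : ('I_n -> int) -> R) N :
  sumZn_part (fun k => u k + v k) N = sumZn_part u N + sumZn_part v N.
Proof. exact: big_split. Qed.

Lemma sumZn_part_nondecreasing (R : realType) n (u : ('I_n -> int) -> R) :
  (forall k, 0 <= u k) -> nondecreasing_seq (sumZn_part u).
Proof.
move=> u0; apply/nondecreasing_seqP => N.
(* Index [j] at level [N] and index [j + 1] at level [N + 1] encode the same integer [j - N], so [h]
   embeds the smaller cube in the larger one. *)
pose h (j : {ffun 'I_n -> 'I_(2 * N).+1}) : {ffun 'I_n -> 'I_(2 * N.+1).+1} :=
  [ffun i => inord (j i).+1].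
have hE j i : h j i = (j i).+1 :> nat.
  rewrite ffunE inordK // mulnS !addSn add0n !ltnS.
  exact: ltnW (ltn_ord (j i)).
have hinj : injective h.
  move=> j1 j2 /ffunP j12; apply/ffunP => i; apply: val_inj.
  by have := congr1 val (j12 i); rewrite /= !hE => -[].
pose F (j : {ffun 'I_n -> 'I_(2 * N.+1).+1}) :=
  u (fun i => (j i)%:Z - N.+1%:Z).
have -> : sumZn_part u N = \sum_(j in h @: [set: _]%SET) F j.
  rewrite big_imset /=; last by move=> ? ? _ _; apply: hinj.
  rewrite /sumZn_part; apply: eq_big => [j|j _]; first by rewrite inE.
  rewrite /F; congr u; apply/funext => i; rewrite hE !intS; ring.
rewrite [leRHS](bigID (mem (h @: [set: _]%SET))) /= lerDl.
exact: sumr_ge0.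
Qed.

(** Both [u + w] and [w] are nonnegative with bounded partial sums, hence converge by monotonicity;
    [u] is their difference. *)
Lemma sumZn_part_cvg (R : realType) n (u w : ('I_n -> int) -> R) M :
  (forall k, `|u k| <= w k) -> (forall N, sumZn_part w N <= M) ->
  cvg (sumZn_part u @ \oo).
Proof.
move=> uw wM.
have ndcvg (v : ('I_n -> int) -> R) (B : R) : (forall k, 0 <= v k) ->
    (forall N, sumZn_part v N <= B) -> cvg (sumZn_part v @ \oo).
  move=> v0 vB; apply: nondecreasing_is_cvgn.
    exact: sumZn_part_nondecreasing.
  by exists B => _ [N _ <-].
have cw : cvg (sumZn_part w @ \oo).
  by apply: ndcvg wM => k; apply: le_trans (uw k).
have cuw : cvg (sumZn_part (fun k => u k + w k) @ \oo).
  apply: (ndcvg _ (M + M)) => [k|N].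
    by have := uw k; rewrite ler_norml => /andP[]; rewrite -lerBlDr sub0r.
  rewrite sumZn_partD; apply: lerD => //; apply: le_trans (wM N).
  by apply: sumZn_part_le => k; exact: le_trans (ler_norm _) (uw k).
rewrite (_ : sumZn_part u =
  sumZn_part (fun k => u k + w k) - sumZn_part w); first exact: is_cvgB.
by apply/funext => N; rewrite !fctE sumZn_partD addrK.
Qed.

(** As the weights [X] sum to 1, subtracting [c] turns the series into that of [X (m - c)],
    dominated by [|X| G]. The domination also gives the convergence without which [sumZn], a [lim],
    would carry no information. *)
Lemma sumZn_weighted_dist_le (R : realType) n (X m G : ('I_n -> int) -> R)
    (c T : R) :
  sumZn_part X @ \oo --> (1 : R) -> (forall k, `|m k - c| <= G k) ->
  (forall N, sumZn_part (fun k => `|X k| * G k) N <= T) ->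
  `|sumZn (fun k => X k * m k) - c| <= T.
Proof.
move=> X1 mG GT; pose v k := X k * (m k - c).
have vG k : `|v k| <= `|X k| * G k by rewrite /v normrM ler_wpM2l.
have cv : cvg (sumZn_part v @ \oo) := sumZn_part_cvg vG GT.
have vT N : `|sumZn_part v N| <= T.
  apply: le_trans (GT N); apply: le_trans (ler_norm_sum _ _ _) _.
  by apply: ler_sum => j _; exact: vG.
have lT : `|lim (sumZn_part v @ \oo)| <= T.
  rewrite ler_norml; apply/andP; split.
    by apply: limr_ge => //; near=> N; have := vT N; rewrite ler_norml => /andP[].
  by apply: limr_le => //; near=> N; have := vT N; rewrite ler_norml => /andP[].
suff -> : sumZn (fun k => X k * m k) = lim (sumZn_part v @ \oo) + c.
  by rewrite addrK.
apply: cvg_lim => //.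
rewrite (_ : sumZn_part _ = (fun N => sumZn_part v N + c * sumZn_part X N)).
  rewrite -[X in _ --> _ + X]mulr1; apply: cvgD => //; exact: cvgMl_tmp.
apply/funext => N; rewrite /sumZn_part mulr_sumr -big_split /=.
by apply: eq_bigr => j _; rewrite /v; ring.
Unshelve. all: by end_near.
Qed.

Lemma sumZn_part_prod_cvg1 (R : realType) n (v : 'I_n -> int -> R) :
  (forall i, sumZ_to (v i) 1) ->
  sumZn_part (fun k => \prod_i v i (k i)) @ \oo --> (1 : R).
Proof.
move=> v1; rewrite (_ : sumZn_part _ = (fun N => \prod_i sumZ_part (v i) N)).
  have := @cvg_big R _ _ 1 xpredT (@mul_continuous R) _ \oo
    (index_enum 'I_n) (fun i N => sumZ_part (v i) N) (fun=> 1) _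
    (fun i _ => v1 i).
  by rewrite big1 //; apply.
by apply/funext => N; rewrite sumZn_part_prod.
Qed.

(** For fixed [j], the part carrying [g j] is a product in which only factor [j] is weighted. Its
    sum over the cube factors into one sum bounded by [B T] and [n - 1] sums bounded by [B]. *)
Lemma sumZn_part_prod_sum_le (R : realType) n (v g : 'I_n -> int -> R)
    (B T : R) N :
  (forall i k, 0 <= v i k) -> (forall i k, 0 <= g i k) ->
  (forall i, sumZ_part (v i) N <= B) ->
  (forall i, sumZ_part (fun k => v i k * g i k) N <= B * T) ->
  sumZn_part (fun k => (\prod_i v i (k i)) * \sum_i g i (k i)) N <=
    n%:R * (B ^+ n * T).
Proof.
move=> v0 g0 vB vT.
pose u j i k := v i k * (if i == j then g i k else 1).
have -> : sumZn_part (fun k => (\prod_i v i (k i)) * \sum_i g i (k i)) N =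
    \sum_j \prod_i sumZ_part (u j i) N.
  under [RHS]eq_bigr do rewrite -sumZn_part_prod.
  rewrite /sumZn_part exchange_big /=; apply: eq_bigr => k _.
  rewrite mulr_sumr; apply: eq_bigr => j _.
  by rewrite big_split /= -big_mkcond big_pred1_eq.
have -> : n%:R * (B ^+ n * T) = \sum_(j < n) B ^+ n * T.
  by rewrite sumr_const card_ord mulr_natl.
apply: ler_sum => j _.
apply: le_trans (_ : \prod_i (B * (if i == j then T else 1)) <= _).
  apply: ler_prod => i _; rewrite /u; case: ifP => _.
    by rewrite vT andbT; apply: sumr_ge0 => k _; rewrite mulr_ge0.
  rewrite mulr1 (le_trans _ (vB i)) ?andbT; last first.
    by apply: ler_sum => k _; rewrite mulr1.
  by apply: sumr_ge0 => k _; rewrite mulr1.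
by rewrite big_split /= prodr_const card_ord -big_mkcond big_pred1_eq.
Qed.

(** * Assembly of the quantitative estimate *)

Unset Implicit Arguments.
Set Strict Implicit.

Theorem mainTheorem1 (R : realType) (n : nat) (hn : (1 <= n)%N)
    (t : 'I_n -> int -> R) (delta Delta : R)
    (Ht : nodes t delta Delta)
    (chi : R -> R)
    (Hker : forall i : 'I_n, kernel1 (t i) chi)
    (HO : exists C A : R, 0 < A /\ forall x : R, A <= `|x| -> `|chi x| <= C * `|x| ^- 2)
    (Hm1 : forall i : 'I_n, ~ finite_moment (t i) chi 1) :
  exists K : R, 0 < K /\
    forall f : ('I_n -> R) -> R, C_Rn f ->
      exists w0 : R, forall w : R, w0 <= w ->
        forall x : 'I_n -> R,
          `|kantorovich t (prodkernel chi) w f x - f x|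
            <= K * (modcont f (ln w / w) + sup_norm f / w).
Proof.
pose i0 : 'I_n := Ordinal hn.
have [C0 [C00 dec]] := kernel1_decay (Hker i0) HO.
have [[d0 dD] gaps _ _ _] := Ht.
have D0 : 0 <= Delta by apply: le_trans dD; exact: ltW.
pose B := C0 * (2 * (1 + delta) ^+ 2 / delta).
have B0 : 0 < B.
  by rewrite mulr_gt0 // divr_gt0 // mulr_gt0 // exprn_gt0 //; lra.
have nD0 : 0 <= n%:R * Delta by rewrite mulr_ge0.
exists (n%:R * (B ^+ n * (10 + n%:R * Delta))); split.
  by rewrite !mulr_gt0 ?exprn_gt0 ?ltr0n //; lra.
(* The threshold, independent of [f], ensures [ln w >= 1]. *)
move=> f [uf bf]; exists (expR 1) => w hw x.
have w1 : 1 <= w by apply: le_trans hw; have := @expR_ge1Dx R 1; lra.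
have w0 : 0 < w by apply: lt_le_trans w1.
have lw : 1 <= ln w by rewrite -[leLHS](expRK (1 : R)) ler_ln ?posrE ?expR_gt0.
have lw0 : 0 < ln w by apply: lt_le_trans lw.
have dd0 : 0 < ln w / w by rewrite divr_gt0.
have om0 := modcont_ge0 bf (ltW dd0).
set om := modcont f _ in om0 *; set S := sup_norm f.
have S0 : 0 <= S := le_trans (normr_ge0 _) (sup_norm_ge x bf).
have Sw0 : 0 <= S / w by rewrite divr_ge0 // ltW.
(* [a] and [b] come from [om (1 + (Y + n Delta) / ln w)], where [Y] is the sum of the coordinate
   distances and [ln w >= 1]; [e] is the trivial bound used when some coordinate is far. *)
pose a := om * (1 + n%:R * Delta); pose b := om / ln w; pose e := 2 * S.
have a0 : 0 <= a by rewrite mulr_ge0 //; lra.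
have b0 : 0 <= b by rewrite divr_ge0 // ltW.
have e0 : 0 <= e by rewrite mulr_ge0.
pose y i k := `|w * x i - t i k|.
have y0 i k : 0 <= y i k := normr_ge0 _.
pose g i k := a + (if y i k <= w then b * y i k else e).
have g0 i k : 0 <= g i k.
  by rewrite /g addr_ge0 //; case: ifP => // _; rewrite mulr_ge0.
pose X (k : 'I_n -> int) := \prod_i chi (w * x i - t i (k i)).
pose m (k : 'I_n -> int) := w ^+ n / (\prod_i (t i (k i + 1) - t i (k i))) *
  boxint n (fun i => t i (k i) / w) (fun i => t i (k i + 1) / w) f.
have dist_near k p : (forall j, t j (k j) / w <= p j <= t j (k j + 1) / w) ->
    (forall i, y i (k i) <= w) -> `|f p - f x| <= \sum_i g i (k i).
  move=> hp yw.
  apply: le_trans (modcont_scale x p bf dd0) _; rewrite -/om.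
  (* A point of the cell is within [Delta / w] of its lower corner in each coordinate. *)
  have px i : `|p i - x i| <= (y i (k i) + Delta) / w.
    rewrite ler_pdivlMr // -{1}(gtr0_norm w0) -normrM.
    have /andP[] := hp i; rewrite ler_pdivrMr // ler_pdivlMr // => p1 p2.
    have [_ p3] := gaps i (k i).
    have -> : (p i - x i) * w = (p i * w - t i (k i)) - (w * x i - t i (k i)).
      by ring.
    apply: le_trans (ler_normB _ _) _; rewrite addrC lerD2l ger0_norm; lra.
  have := norm2_le_sum px; rewrite -mulr_suml big_split /= sumr_const card_ord.
  rewrite -[Delta *+ n]mulr_natl; set Y := \sum_i _ => hN.
  have Y0 : 0 <= Y by apply: sumr_ge0.
  have -> : \sum_i g i (k i) = n%:R * a + b * Y.
    under eq_bigr do rewrite /g yw.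
    by rewrite big_split /= sumr_const card_ord mulr_natl mulr_sumr.
  have na : a <= n%:R * a by rewrite ler_peMl // ler1n.
  apply: le_trans (lerD na (lexx _)).
  apply: le_trans (_ : om * (1 + (Y + n%:R * Delta) / ln w) <= _).
    rewrite ler_wpM2l // lerD2l ler_pdivrMr //; apply: le_trans hN _.
    by rewrite mulrA divfK ?lt0r_neq0.
  rewrite /a /b -[om / _ * Y]mulrA -mulrDr ler_wpM2l //.
  have : n%:R * Delta * (ln w)^-1 <= n%:R * Delta.
    by rewrite ler_pdivrMr // ler_peMr.
  lra.
have dist_far k p i : w < y i (k i) -> `|f p - f x| <= \sum_i g i (k i).
  move=> yw; apply: le_trans (_ : g i (k i) <= _); last first.
    by rewrite [leRHS](bigD1 i) //= lerDl sumr_ge0.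
  rewrite /g [_ <= w]leNgt yw /=; apply: ler_wpDl => //.
  apply: le_trans (ler_normB _ _) _.
  by have := sup_norm_ge p bf; have := sup_norm_ge x bf; rewrite /e /S; lra.
have mG k : `|m k - f x| <= \sum_i g i (k i).
  (* The Kantorovich normalisation is the reciprocal of the volume of the cell, so [m k] is a mean
     of [f]. *)
  have E : (\prod_i (t i (k i + 1) / w - t i (k i) / w))^-1 =
      w ^+ n / \prod_i (t i (k i + 1) - t i (k i)).
    under eq_bigr do rewrite -mulrBl.
    by rewrite big_split /= prodr_const card_ord exprVn invfM invrK mulrC.
  rewrite /m -E; apply: boxint_mean_dist_le => //.
  - move=> i; rewrite ltr_pM2r ?invr_gt0 //.
    by have [+ _] := gaps i (k i); lra.
  - exact: sumr_ge0.
  move=> p hp; have [|] := boolP [forall i, y i (k i) <= w].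
    by move/forallP; exact: dist_near.
  by rewrite negb_forall => /existsP[i]; rewrite -ltNge; exact: dist_far.
have gap1 i k : delta <= t i (k + 1) - t i k by have [] := gaps i k.
have massB i N : sumZ_part (fun k => `|chi (w * x i - t i k)|) N <= B.
  (* The constant weight 1 gives the plain absolute sum. *)
  have := @sum_decay_weight_le R chi (t i) C0 delta w 1 0 0 (w * x i) N
    d0 lw w1 (gap1 i) dec ltac:(lra) (lexx _) (lexx _).
  rewrite !mul0r !mulr0 !addr0 mulr1; apply: le_trans.
  by apply: sumZ_part_le => k; rewrite mul0r if_same addr0 mulr1.
(* For these weights [a + 9 b ln w + 4 e / w] equals [om (10 + n Delta) + 8 S / w], which is at most
   [T]. *)
pose T := (10 + n%:R * Delta) * (om + S / w).
have weightB i N :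
    sumZ_part (fun k => `|chi (w * x i - t i k)| * g i k) N <= B * T.
  apply: le_trans (@sum_decay_weight_le R chi (t i) C0 delta w a b e (w * x i)
    N d0 lw w1 (gap1 i) dec a0 b0 e0) _.
  rewrite -/B ler_pM2l // /b divfK ?lt0r_neq0 // /a /e /T.
  have := mulr_ge0 nD0 Sw0; rewrite -[2 * S / w]mulrA; lra.
have -> : kantorovich t (prodkernel chi) w f x = sumZn (fun k => X k * m k).
  rewrite /kantorovich; congr sumZn; apply/funext => k.
  by rewrite /X /m /prodkernel -[LHS]mulrA.
rewrite -[leRHS]mulrA -[X in _ <= _ * X]mulrA -/T.
apply: (sumZn_weighted_dist_le (G := fun k => \sum_i g i (k i))) => //.
  apply: (sumZn_part_prod_cvg1 (v := fun i k => chi (w * x i - t i k))) => i.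
  by have [_ _ + _] := Hker i; exact.
move=> N; under [X in sumZn_part X _]eq_fun do rewrite /X normr_prod.
by apply: (sumZn_part_prod_sum_le (v := fun i k => `|chi (w * x i - t i k)|)).
Qed.
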